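(* For any increasing range map $\delta$ and any $n\geq 0$, the map $\mathbf{e}_{\mathsf{Hi}_\delta}^{-1}\circ\mathbf{e}_{\mathsf{Ca}_\delta}$ is a (well-defined) bijection between $\mathsf{Ca}_\delta(n)$ and $\mathsf{Hi}_\delta(n)$.
   Context: $\mathbb{N}=\{0,1,2,\dots\}$. A range map is a map $\delta:\mathbb{N}\setminus\{0\}\to\mathbb{N}$; it is increasing if $\delta(i)<\delta(i+1)$ for all $i\geq1$. A $\delta$-cliff of size $n$ is a word $u=u_1\cdots u_n$ of nonnegative integers with $u_i\leq\delta(i)$ for all $i$; $\mathsf{Cl}_\delta(n)$ is the set of them. $\mathsf{Hi}_\delta(n)$ is the set of $\delta$-cliffs $u$ of size $n$ ($\delta$-hills) with $u_i\leq u_{i+1}$ for all $1\leq i\leq n-1$. $\mathsf{Ca}_\delta(n)$ is the set of $\delta$-cliffs $u$ of size $n$ ($\delta$-canyons) such that $u_{i-j}\leq u_i-j$ for all $i\in\{1,\dots,n\}$ and all $j\in\{1,\dots,u_i\}$ with $i-j\geq1$. Let $\mathcal{S}=\bigsqcup_n\mathcal{S}(n)$ be a set of $\delta$-cliffs graded by size and closed under taking prefixes (both $\mathsf{Hi}_\delta$ and $\mathsf{Ca}_\delta$ are). For $u\in\mathcal{S}(k)$ let $\mathrm{F}_{\mathcal{S}}(u):=\{a\in\{0,\dots,\delta(k+1)\}:ua\in\mathcal{S}\}$. The $\mathcal{S}$-elevation map $\mathbf{e}_{\mathcal{S}}:\mathcal{S}(n)\to\mathsf{Cl}_\delta(n)$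 is defined by $\mathbf{e}_{\mathcal{S}}(u)_i:=\#\{a\in\mathrm{F}_{\mathcal{S}}(u_1\cdots u_{i-1}):a<u_i\}$ for all $1\leq i\leq n$. This map is injective on $\mathcal{S}(n)$, and $\mathbf{e}_{\mathcal{S}}^{-1}$ denotes its inverse, defined on its image. *)

(* Defs.v *)
From mathcomp Require Import all_boot.
From mathcomp Require Import boolp classical_sets functions.

Set Implicit Arguments.
Unset Strict Implicit.
Unset Printing Implicit Defensive.

(* A range map is a function on the positive integers; it is
   encoded as a total [delta : nat -> nat] whose value at 0 is never used. *)
Definition increasing_range_map (delta : nat -> nat) : Prop :=
  forall i, 0 < i -> delta i < delta i.+1.

(* Letters are numbered from 1, as in u = u_1 ... u_n. *)
Definition letter (u : seq nat) (i : nat) : nat := nth 0 u i.-1.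

Definition cliff (delta : nat -> nat) : pred (seq nat) := fun u =>
  all (fun i => letter u i <= delta i) (iota 1 (size u)).

Definition hill (delta : nat -> nat) : pred (seq nat) := fun u =>
  cliff delta u &&
  all (fun i => letter u i <= letter u i.+1) (iota 1 (size u).-1).

(* The subtraction [letter u i - j] never truncates, since j <= u_i. *)
Definition canyon (delta : nat -> nat) : pred (seq nat) := fun u =>
  cliff delta u &&
  all (fun i =>
    all (fun j => (1 <= i - j) ==> (letter u (i - j) <= letter u i - j))
        (iota 1 (letter u i)))
    (iota 1 (size u)).

(* A graded set S of words is a predicate on words; [of_size S n] is S(n). *)
Definition of_size (S : pred (seq nat)) (n : nat) : set (seq nat) :=
  [set u | S u /\ size u = n]%classic.

Definition prefix_closed (S : pred (seq nat)) : Prop :=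
  forall u v, prefix u v -> S v -> S u.

(* F_S(u), listed in increasing order without repetition. *)
Definition next_letters (delta : nat -> nat) (S : pred (seq nat))
    (u : seq nat) : seq nat :=
  [seq a <- iota 0 (delta (size u).+1).+1 | S (rcons u a)].

Definition elevation (delta : nat -> nat) (S : pred (seq nat))
    (u : seq nat) : seq nat :=
  [seq count (fun a => a < letter u i) (next_letters delta S (take i.-1 u))
     | i <- iota 1 (size u)].

(* Inverse of the elevation map restricted to S(n), defined on its image; the
   empty word is the irrelevant value outside this image. *)
Definition elevation_inv (delta : nat -> nat) (S : pred (seq nat)) (n : nat)
    : seq nat -> seq nat :=
  'pinv_(fun=> [::]) (of_size S n) (elevation delta S).

Lemma iota1S m : iota 1 m.+1 = iota 1 m ++ [:: m.+1].
Proof. by rewrite -[m.+1 in LHS]addn1 iotaD add1n. Qed.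

Lemma cliff_rcons delta u a :
  cliff delta (rcons u a) = cliff delta u && (a <= delta (size u).+1).
Proof.
rewrite /cliff size_rcons iota1S all_cat /= andbT.
congr (_ && _); last by rewrite /letter /= nth_rcons ltnn eqxx.
apply: eq_in_all => i; rewrite mem_iota add1n ltnS => /andP[i0 iu].
by rewrite /letter nth_rcons prednK // iu.
Qed.

Lemma prefix_closed_rcons (S : pred (seq nat)) :
  (forall u a, S (rcons u a) -> S u) -> prefix_closed S.
Proof.
move=> H u v /prefixP[w ->] {v}.
by elim/last_ind: w => [|w a IH]; rewrite ?cats0 // -rcons_cat => /H.
Qed.

Lemma letter_rcons u a i : 0 < i <= size u -> letter (rcons u a) i = letter u i.
Proof. by case: i => // i; rewrite /letter nth_rcons /= => ->. Qed.

Lemma hill_prefix_closed delta : prefix_closed (hill delta).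
Proof.
apply: prefix_closed_rcons => u a /andP[]; rewrite cliff_rcons.
move=> /andP[cu _] /allP H; rewrite /hill cu; apply/allP => i.
rewrite mem_iota add1n => /andP[i0 ilt].
have iu : i < size u by move: ilt i0; case: (size u) => [|m] //=; case: i.
have := H i; rewrite !letter_rcons ?i0 ?(ltnW iu) //=; apply.
by rewrite mem_iota size_rcons i0 add1n ltnS ltnW.
Qed.

Lemma canyon_prefix_closed delta : prefix_closed (canyon delta).
Proof.
apply: prefix_closed_rcons => u a /andP[]; rewrite cliff_rcons.
move=> /andP[cu _] /allP H; rewrite /canyon cu; apply/allP => i.
rewrite mem_iota add1n ltnS => /andP[i0 iu].
have := H i; rewrite mem_iota size_rcons i0 add1n ltnS (leqW iu) => /(_ isT).
rewrite letter_rcons ?i0 // => /allP K; apply/allP => j /K /implyP L.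
apply/implyP => ij; move: (L ij); rewrite letter_rcons // ij.
exact: leq_trans (leq_subr _ _) iu.
Qed.

Lemma elevation_rcons delta S u a :
  elevation delta S (rcons u a) =
  rcons (elevation delta S u) (count (fun b => b < a) (next_letters delta S u)).
Proof.
rewrite /elevation size_rcons iota1S map_cat -[RHS]cats1 /=.
congr (_ ++ _); last first.
  by rewrite /letter /= nth_rcons ltnn eqxx -cats1 take_size_cat.
apply/eq_in_map => i; rewrite mem_iota add1n ltnS => /andP[i0 iu].
by rewrite letter_rcons ?i0 // -cats1 takel_cat // (leq_trans (leq_pred _)).
Qed.

Lemma count_lt_mono (s : seq nat) a b :
  a \in s -> a < b -> count (fun c => c < a) s < count (fun c => c < b) s.
Proof.
move=> sa ab.
have : count (pred1 a) s + count (fun c => c < a) s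
       <= count (fun c => c < b) s.
  rewrite -count_predUI [X in _ + X](_ : _ = 0) ?addn0.
    by apply: sub_count => c /= /orP[/eqP->|/ltn_trans]; last exact.
  by apply/eqP; rewrite -leqn0 leqNgt -has_count; apply/hasP=> -[c _ /=];
     case: eqP => // ->; rewrite ltnn.
apply: leq_trans.
by rewrite -[X in X < _]add0n ltn_add2r -has_count; apply/hasP; exists a => //=.
Qed.

Lemma elevation_inj delta (S : pred (seq nat)) n :
  (forall u, S u -> cliff delta u) -> prefix_closed S ->
  set_inj (of_size S n) (elevation delta S).
Proof.
move=> Scliff Sp u v /set_mem[Su <-] /set_mem[Sv /esym].
elim/last_ind: u v Su Sv => [|u a IH] v.
  by move=> _ _ /esym/size0nil ->.
elim/last_ind: v => [|v b _] Sua Svb; first by rewrite size_rcons.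
rewrite !size_rcons !elevation_rcons => -[szuv] /rcons_inj[].
have px (w : seq nat) c : prefix w (rcons w c) by rewrite -cats1 prefix_prefix.
move=> /(IH _ (Sp _ _ (px _ _) Sua) (Sp _ _ (px _ _) Svb) szuv) uv.
rewrite -uv in Svb *.
have inF c : S (rcons u c) -> c \in next_letters delta S u.
  move=> Sc; rewrite mem_filter Sc mem_iota /= add0n ltnS.
  by have := Scliff _ Sc; rewrite cliff_rcons => /andP[].
have [ab|ba|->] // := ltngtP a b.
- by have := count_lt_mono (inF _ Sua) ab => /[swap] ->; rewrite ltnn.
- by have := count_lt_mono (inF _ Svb) ba => /[swap] ->; rewrite ltnn.
Qed.

(* [elevation_inv] is a genuine inverse, independent of the default value. *)
Lemma elevation_hill_invK delta n :
  {in of_size (hill delta) n,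
    cancel (elevation delta (hill delta)) (elevation_inv delta (hill delta) n)}.
Proof.
apply: pinvKV; apply: elevation_inj; last exact: hill_prefix_closed.
by move=> u /andP[].
Qed.

(* Main.v *)
Require Import Defs.
From mathcomp Require Import all_boot.
From mathcomp Require Import order.
From mathcomp Require Import boolp classical_sets functions.
From mathcomp Require Import zify.

Set Implicit Arguments.
Unset Strict Implicit.

(** An elevation records, letter by letter, the rank of the chosen letter among
    the allowed ones.  Hence, if in two families of words the number of letters
    that may follow a word is the same function of the elevation of that word,
    then the two families have the same elevations
    ([elevation_transfer]).

    For hills and canyons alike, exactly [delta k.+1 + 1 - s] letters may follow
    a word of size [k] whose elevation sums to [s] ([hill_num_next_letters],
    [canyon_num_next_letters]).  For a hill, the letters below the last one are
    excluded, and the elevation lists the increments, so that [s] is the last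
    letter.  For a canyon, place the letter [a] in position [i] at height
    [a - i].  The letter [u_m] then forbids the heights of the interval
    [[- m, u_m - m)] in all later positions.  A letter that is itself allowed
    newly forbids exactly the allowed heights below its own, and these are
    counted by its entry in the elevation; so [s] is the number of forbidden
    heights.  As [delta] is increasing, all of them are heights of letters within
    the range of the next position, whose [delta k.+1 + 1] values therefore
    lose exactly [s].

    Both elevation maps are injective, so equality of their images gives the
    bijection. *)

(** * Words with prescribed elevations *)

Lemma prefix_closed_belast (S : pred (seq nat)) u a :
  prefix_closed S -> S (rcons u a) -> S u.
Proof. by move=> Sp; apply: Sp; rewrite -cats1 prefix_prefix. Qed.

Lemma mem_next_letters delta (S : pred (seq nat)) u a :
  (a \in next_letters delta S u) = S (rcons u a) && (a <= delta (size u).+1).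
Proof. by rewrite mem_filter mem_iota add0n ltnS. Qed.

Lemma size_elevation delta S u : size (elevation delta S u) = size u.
Proof. by rewrite size_map size_iota. Qed.

(** The word of [S'] is built along [u]: at each step, the letter of [u] has
    fewer smaller competitors than there are allowed letters, and [S'] has as
    many of these, so it offers a letter of the same rank. *)
Lemma elevation_transfer delta (S S' : pred (seq nat)) (f : seq nat -> nat) :
  (forall u, S u -> cliff delta u) -> prefix_closed S -> S' [::] ->
  (forall u, S u -> size (next_letters delta S u) = f (elevation delta S u)) ->
  (forall u, S' u ->
     size (next_letters delta S' u) = f (elevation delta S' u)) ->
  forall u, S u ->
    exists2 u', S' u' & elevation delta S' u' = elevation delta S u.
Proof.
move=> Scliff Sp S'0 fS fS'; elim/last_ind => [|u a IH] Sua; first by exists [::].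
have Su := prefix_closed_belast Sp Sua.
have [u' S'u' eq_e] := IH Su.
set s := next_letters delta S u; set s' := next_letters delta S' u'.
have as_ : a \in s.
  rewrite mem_next_letters Sua.
  by have := Scliff _ Sua; rewrite cliff_rcons => /andP[].
have lt_c : count (fun b => b < a) s < size s'.
  rewrite fS' // eq_e -fS // -(count_predC (fun b => b < a)) -[X in X < _]addn0.
  by rewrite ltn_add2l -has_count; apply/hasP; exists a; rewrite //= ltnn.
have := mem_nth 0 lt_c; rewrite mem_next_letters => /andP[S'u'b _].
eexists; first exact: S'u'b.
rewrite !elevation_rcons eq_e.
congr (rcons _ _); apply: (Order.POrderTheory.count_lt_nth 0) => //.
by apply: sorted_filter; [exact: ltn_trans | exact: iota_ltn_sorted].
Qed.

Lemma count_next_letters delta (S : pred (seq nat)) (P : pred nat) u :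
  count P (next_letters delta S u) =
  count (fun a => P a && S (rcons u a)) (iota 0 (delta (size u).+1).+1).
Proof. by rewrite count_filter. Qed.

Lemma count_iota_leq_ltn l b n :
  count (fun a => l <= a < b) (iota 0 n) = minn b n - l.
Proof.
elim: n => [|n IH]; first by rewrite minn0.
by rewrite -addn1 iotaD count_cat IH /= addn0 add0n; lia.
Qed.

(** * Hills *)

Lemma hill_rcons delta u a :
  hill delta (rcons u a) =
  [&& hill delta u, a <= delta (size u).+1 & last 0 u <= a].
Proof.
rewrite /hill cliff_rcons size_rcons /=.
case/lastP: u => [|u b]; first by rewrite /= !andbT.
set v := rcons u b; have szv : size v = (size u).+1 by rewrite size_rcons.
rewrite szv iota1S all_cat /= andbT -szv letter_rcons ?szv ?ltnSn //.
have -> : letter v (size u).+1 = last 0 v by rewrite -nth_last szv.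
have -> : letter (rcons v a) (size u).+2 = a.
  by rewrite /letter -szv nth_rcons ltnn eqxx.
rewrite (@eq_in_all _ _ (fun i => letter v i <= letter v i.+1)).
  by rewrite -!andbA; congr (_ && _); rewrite andbCA.
move=> i; rewrite mem_iota => /andP[i0 iu].
by rewrite (@letter_rcons v a i) ?(@letter_rcons v a i.+1) // szv; lia.
Qed.

Lemma count_next_letters_hill delta u b :
  hill delta u -> b <= (delta (size u).+1).+1 ->
  count (fun a => a < b) (next_letters delta (hill delta) u) = b - last 0 u.
Proof.
move=> hu bd; rewrite count_next_letters -{2}(minn_idPl bd) -count_iota_leq_ltn.
apply: eq_in_count => a; rewrite mem_iota add0n ltnS => /andP[_ ad].
by rewrite hill_rcons hu ad andbC.
Qed.

Lemma sumn_elevation_hill delta u :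
  hill delta u -> sumn (elevation delta (hill delta) u) = last 0 u.
Proof.
elim/last_ind: u => [//|u a IH]; rewrite hill_rcons => /and3P[hu ad la].
rewrite last_rcons elevation_rcons sumn_rcons IH // count_next_letters_hill //.
  by rewrite subnKC.
exact: leqW.
Qed.

Lemma hill_num_next_letters delta u :
  hill delta u ->
  size (next_letters delta (hill delta) u) =
  (delta (size u).+1).+1 - sumn (elevation delta (hill delta) u).
Proof.
move=> hu; rewrite sumn_elevation_hill // -(count_next_letters_hill hu) // -count_predT.
apply: eq_in_count => a; rewrite mem_next_letters => /andP[_ ad].
by rewrite ltnS ad.
Qed.

(** * Canyons *)

(** The letter at distance [j] to the left of the next position forbids there
    the letters [a] with [j <= a < letter + j]. *)
Definition blocked (u : seq nat) (a : nat) : bool :=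
  has (fun j => (1 <= (size u).+1 - j) &&
                (a - j < letter u ((size u).+1 - j))) (iota 1 a).

Lemma canyon_rcons delta u a :
  canyon delta (rcons u a) =
  [&& canyon delta u, a <= delta (size u).+1 & ~~ blocked u a].
Proof.
rewrite /canyon cliff_rcons size_rcons iota1S all_cat /= andbT.
have -> : letter (rcons u a) (size u).+1 = a.
  by rewrite /letter nth_rcons ltnn eqxx.
have -> : all (fun j => (1 <= (size u).+1 - j) ==>
      (letter (rcons u a) ((size u).+1 - j) <= a - j)) (iota 1 a)
    = ~~ blocked u a.
  rewrite /blocked -all_predC; apply: eq_in_all => j.
  rewrite mem_iota /= negb_and -leqNgt => /andP[j0 _].
  by rewrite implybE; case: ltnP => //= ju; rewrite letter_rcons //; lia.
rewrite (@eq_in_all _ _ (fun i => all (fun j => (1 <= i - j) ==>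
    (letter u (i - j) <= letter u i - j)) (iota 1 (letter u i)))).
  by rewrite -!andbA; congr (_ && _); rewrite andbCA.
move=> i; rewrite mem_iota => /andP[i0 iu].
rewrite letter_rcons; last by lia.
apply: eq_all => j; case: (ltnP 0 (i - j)) => //= ij.
by rewrite letter_rcons //; lia.
Qed.

(** Moving one position to the right shifts the forbidden letters by one and
    adds those forbidden by the letter just passed. *)
Lemma blocked_rcons u b a :
  blocked (rcons u b) a.+1 = blocked u a || (a < b).
Proof.
rewrite /blocked size_rcons /= orbC; congr (_ || _); last first.
  by rewrite !subn1 /= /letter nth_rcons ltnn eqxx.
rewrite (iotaDl 1 1) has_map; apply: eq_in_has => j.
rewrite mem_iota /= => /andP[j0 _]; rewrite add1n !subSS.
by case: (ltnP 0 ((size u).+1 - j)) => //= ju; rewrite letter_rcons //; lia.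
Qed.

(** The letters forbidden after [u a] are those forbidden after [u], together
    with the allowed letters below [a], which the new entry of the elevation
    counts.  Any bound [N] above [delta (size u)] sees them all: with
    [k = size u], the letter at distance [j] is at most [delta (k.+1 - j) <= delta k + 1 - j], as
    [delta] is increasing, so it forbids no letter above [delta k]. *)
Lemma count_blocked delta u N :
  increasing_range_map delta -> canyon delta u ->
  (0 < size u -> delta (size u) < N) ->
  count (blocked u) (iota 0 N) = sumn (elevation delta (canyon delta) u).
Proof.
move=> dinc; elim/last_ind: u N => [|u b IH] N.
  move=> _ _; rewrite (@eq_count _ _ pred0) ?count_pred0 // => a.
  by apply/hasP => -[j]; rewrite mem_iota /letter nth_nil ltn0 andbF.
rewrite canyon_rcons size_rcons => /and3P[cu bd _] /(_ isT).
case: N => // N; rewrite ltnS => dN.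
rewrite /= add0n (iotaDl 1 0) count_map elevation_rcons sumn_rcons.
rewrite -(IH N) //; last by move/dinc/leq_trans; apply.
rewrite (@eq_count _ _ (predU (blocked u) (fun a => (a < b) && ~~ blocked u a)));
  last by move=> a /=; rewrite add1n blocked_rcons; case: blocked; rewrite ?andbT.
rewrite -[LHS]addn0 -[X in _ + X](_ : count (predI (blocked u)
  (fun a => (a < b) && ~~ blocked u a)) (iota 0 N) = 0); last first.
  rewrite (@eq_count _ _ pred0) ?count_pred0 // => a /=.
  by rewrite andbCA andbN andbF.
rewrite count_predUI; congr (_ + _).
(* The two ranges of letters differ, but both contain all letters below [b]. *)
have trunc M : b <= M -> count (fun a => (a < b) && ~~ blocked u a) (iota 0 M)
    = count (fun a => ~~ blocked u a) (iota 0 b).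
  move=> bM; rewrite -(subnKC bM) iotaD count_cat add0n.
  rewrite [X in _ + X](@eq_in_count _ _ pred0) ?count_pred0 ?addn0.
    by apply: eq_in_count => a; rewrite mem_iota add0n => /= ->.
  by move=> a; rewrite mem_iota => /andP[ba _]; rewrite ltnNge ba.
rewrite trunc ?(leq_trans bd) // -(trunc (delta (size u).+1).+1) ?leqW //.
rewrite count_next_letters; apply: eq_in_count => a.
by rewrite mem_iota ltnS canyon_rcons cu => /andP[_ ->].
Qed.

Lemma canyon_num_next_letters delta u :
  increasing_range_map delta -> canyon delta u ->
  size (next_letters delta (canyon delta) u) =
  (delta (size u).+1).+1 - sumn (elevation delta (canyon delta) u).
Proof.
move=> dinc cu; set N := _.+1.
rewrite -(@count_blocked _ _ N) // => [|/dinc/leqW //].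
have := count_predC (blocked u) (iota 0 N); rewrite size_iota => eqN.
rewrite -{1}eqN addKn size_filter.
apply: eq_in_count => a.
by rewrite mem_iota ltnS canyon_rcons cu => /andP[_ ->].
Qed.

(** * The bijection *)

Local Open Scope classical_set_scope.

Theorem proposition2p3p6 (delta : nat -> nat) (n : nat) :
  increasing_range_map delta ->
  elevation delta (canyon delta) @` of_size (canyon delta) n
    `<=` elevation delta (hill delta) @` of_size (hill delta) n /\
  set_bij (of_size (canyon delta) n) (of_size (hill delta) n)
    (elevation_inv delta (hill delta) n \o elevation delta (canyon delta)).
Proof.
move=> dinc.
pose f v := (delta (size v).+1).+1 - sumn v.
have fH u : hill delta u ->
    size (next_letters delta (hill delta) u) = f (elevation delta (hill delta) u).
  by move=> hu; rewrite /f size_elevation hill_num_next_letters.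
have fC u : canyon delta u ->
    size (next_letters delta (canyon delta) u)
    = f (elevation delta (canyon delta) u).
  by move=> cu; rewrite /f size_elevation canyon_num_next_letters.
have Hcliff u : hill delta u -> cliff delta u by case/andP.
have Ccliff u : canyon delta u -> cliff delta u by case/andP.
have HP := @hill_prefix_closed delta; have CP := @canyon_prefix_closed delta.
have toHill u : of_size (canyon delta) n u -> exists2 v,
    of_size (hill delta) n v &
    elevation delta (hill delta) v = elevation delta (canyon delta) u.
  move=> [cu szu]; have [v hv e] := elevation_transfer Ccliff CP isT fC fH cu.
  by exists v => //; split=> //; rewrite -(size_elevation delta (hill delta)) e
    size_elevation.
have toCanyon v : of_size (hill delta) n v -> exists2 u,
    of_size (canyon delta) n u &
    elevation delta (canyon delta) u = elevation delta (hill delta) v.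
  move=> [hv szv]; have [u cu e] := elevation_transfer Hcliff HP isT fH fC hv.
  by exists u => //; split=> //; rewrite -(size_elevation delta (canyon delta)) e
    size_elevation.
have invK v : of_size (hill delta) n v ->
    elevation_inv delta (hill delta) n (elevation delta (hill delta) v) = v.
  by move=> hv; apply: elevation_hill_invK; apply/mem_set.
split; first by move=> _ [u /toHill[v hv e] <-]; exists v.
split.
- by move=> u /toHill[v hv e] /=; rewrite -e invK.
- move=> u u' Cu Cu' /=.
  have [v hv e] := toHill _ (set_mem Cu).
  have [v' hv' e'] := toHill _ (set_mem Cu').
  rewrite -e -e' !invK // => vv'.
  by apply: (elevation_inj Ccliff CP Cu Cu'); rewrite -e -e' vv'.
- by move=> v hv; have [u cu e] := toCanyon _ hv; exists u; rewrite //= e invK.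
Qed.
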